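(* Partition the coordinates of $x\in\mathbb{R}^n$ into $m$ non-overlapping groups, $x^\top=[x_1^\top,\dots,x_m^\top]$, and correspondingly $A=[A_1\ A_2\cdots A_m]\in\mathbb{R}^{d\times n}$. Let $b\in\mathbb{R}^d$, $\lambda>0$, $\rho_1,\dots,\rho_m>0$, and let $x^\star$ be an optimal solution of the group lasso problem $$\min_{x\in\mathbb{R}^n}\ \tfrac12\|Ax-b\|_2^2+\lambda\sum_{g=1}^m\sqrt{\rho_g}\,\|x_g\|_2 .$$ Then for every $x\in\mathbb{R}^n$ and every group $g$, $$\|A_g^\top(Ax-b)\|_2+\sqrt{2\,G(x)}\,\|A_g\|_{\mathrm{Fro}}<\lambda\sqrt{\rho_g}\ \Longrightarrow\ x_g^\star=0 ,$$ where $G(x)$ is the duality gap.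
   Context: $\|\cdot\|_{\mathrm{Fro}}$ is the Frobenius norm. The duality gap at $x$ of a problem $\min_x f(Ax)+h(x)$, with $f$ differentiable convex and $h$ closed convex, is $G(x)=f(Ax)+h(x)+f^*(w(x))+h^*(-A^\top w(x))\in[0,+\infty]$ with $w(x)=\nabla f(Ax)$, where $\phi^*(v)=\sup_u v^\top u-\phi(u)$ is the convex conjugate. Here $f(u)=\frac12\|u-b\|_2^2$ (so $w(x)=Ax-b$) and $h(x)=\lambda\sum_g\sqrt{\rho_g}\|x_g\|_2$. The hypothesis of the implication is considered not to hold when $G(x)=+\infty$. *)

(* Defs.v *)
From mathcomp Require Import all_boot all_order all_algebra.
From mathcomp Require Import all_classical all_reals all_analysis.
Set Implicit Arguments.
Unset Strict Implicit.
Unset Printing Implicit Defensive.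
Import Order.TTheory GRing.Theory Num.Theory.
Import numFieldNormedType.Exports.
Local Open Scope ring_scope.

(* The canonical norm `|x| on matrices is the max norm, hence the explicit
   Euclidean and Frobenius norms below. *)
Definition l2norm (R : realType) k (x : 'cV[R]_k) : R :=
  Num.sqrt (\sum_i x i 0 ^+ 2).

Definition frobenius_norm (R : realType) p q (M : 'M[R]_(p, q)) : R :=
  Num.sqrt (\sum_i \sum_j M i j ^+ 2).

Definition dotv (R : realType) k (v u : 'cV[R]_k) : R := \sum_i v i 0 * u i 0.

Definition gradient (R : realType) k (f : 'cV[R]_k -> R) (u : 'cV[R]_k) :
    'cV[R]_k :=
  \col_i 'D_(delta_mx i 0) f u.

Definition convex_conjugate (R : realType) k (phi : 'cV[R]_k -> \bar R)
    (v : 'cV[R]_k) : \bar R :=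
  ereal_sup [set ((dotv v u)%:E - phi u)%E | u in [set: 'cV[R]_k]].

(* For h never equal to -oo and somewhere finite, no summand is -oo, so the
   value is the usual one and the convention for +oo - oo is never used. *)
Definition duality_gap (R : realType) d n (f : 'cV[R]_d -> R)
    (h : 'cV[R]_n -> \bar R) (A : 'M[R]_(d, n)) (x : 'cV[R]_n) : \bar R :=
  let w := gradient f (A *m x) in
  ((f (A *m x))%:E + h x + convex_conjugate (EFin \o f) w
    + convex_conjugate h (- (A^T *m w)))%E.

(* Blocks attached to a set S of coordinates, listed in increasing order. *)
Definition subvector (R : realType) n (S : {set 'I_n}) (x : 'cV[R]_n) :
    'cV[R]_#|S| :=
  rowsub (fun k : 'I_#|S| => enum_val k) x.

Definition subcolumns (R : realType) d n (S : {set 'I_n})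
    (A : 'M[R]_(d, n)) : 'M[R]_(d, #|S|) :=
  colsub (fun k : 'I_#|S| => enum_val k) A.

Definition least_squares (R : realType) d (b u : 'cV[R]_d) : R :=
  2^-1 * l2norm (u - b) ^+ 2.

Definition group_penalty (R : realType) n m (grp : 'I_m -> {set 'I_n})
    (lambda : R) (rho : 'I_m -> R) (x : 'cV[R]_n) : R :=
  lambda * \sum_g Num.sqrt (rho g) * l2norm (subvector (grp g) x).

Definition group_lasso_gap (R : realType) d n m (grp : 'I_m -> {set 'I_n})
    (A : 'M[R]_(d, n)) (b : 'cV[R]_d) (lambda : R) (rho : 'I_m -> R)
    (x : 'cV[R]_n) : \bar R :=
  duality_gap (least_squares b) (EFin \o group_penalty grp lambda rho) A x.

(* Main.v *)
(* Let phi be the objective and h the penalty. Weak duality gives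
   G(x) >= phi(x) - phi(xstar). First-order optimality of xstar reads
     <A xstar - b, A (y - xstar)> + h(y) - h(xstar) >= 0   for every y,
   and since the quadratic term of f is exactly |A (x - xstar)|^2 / 2, it yields
   phi(x) - phi(xstar) >= |A (x - xstar)|^2 / 2; hence
   |A (x - xstar)| <= sqrt (2 G(x)) and the screening hypothesis transfers from
   x to xstar as |A_g^T (A xstar - b)| < lambda sqrt(rho_g). Taking for y the
   vector xstar with its group g set to zero, Cauchy-Schwarz then forces
   xstar_g = 0. *)
Require Import Defs.
From mathcomp Require Import all_boot all_order all_algebra.
From mathcomp Require Import all_classical all_reals all_analysis.
From mathcomp Require Import ring lra.
Set Implicit Arguments.
Unset Strict Implicit.
Unset Printing Implicit Defensive.
Import Order.TTheory GRing.Theory Num.Theory.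
Import numFieldNormedType.Exports.
Local Open Scope ring_scope.

(** * Euclidean inner product, Cauchy-Schwarz and the Frobenius bound *)

Section EuclideanSpace.
Variable R : realType.

Lemma dotvC k (u v : 'cV[R]_k) : dotv u v = dotv v u.
Proof. by apply: eq_bigr => i _; rewrite mulrC. Qed.

Lemma dotvDl k (u v w : 'cV[R]_k) : dotv (u + v) w = dotv u w + dotv v w.
Proof.
by rewrite /dotv -big_split; apply: eq_bigr => i _; rewrite mxE mulrDl.
Qed.

Lemma dotvZl k a (u w : 'cV[R]_k) : dotv (a *: u) w = a * dotv u w.
Proof.
by rewrite /dotv mulr_sumr; apply: eq_bigr => i _; rewrite mxE mulrA.
Qed.

Lemma dotvNl k (u w : 'cV[R]_k) : dotv (- u) w = - dotv u w.
Proof. by rewrite -scaleN1r dotvZl mulN1r. Qed.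

Lemma dotvDr k (w u v : 'cV[R]_k) : dotv w (u + v) = dotv w u + dotv w v.
Proof. by rewrite dotvC dotvDl !(dotvC w). Qed.

Lemma dotvZr k a (w u : 'cV[R]_k) : dotv w (a *: u) = a * dotv w u.
Proof. by rewrite dotvC dotvZl dotvC. Qed.

Lemma dotvNr k (w u : 'cV[R]_k) : dotv w (- u) = - dotv w u.
Proof. by rewrite dotvC dotvNl dotvC. Qed.

Lemma dotv_trmx d n (A : 'M[R]_(d, n)) u v :
  dotv (A^T *m u) v = dotv u (A *m v).
Proof.
have dotE k (p q : 'cV[R]_k) : dotv p q = (p^T *m q) 0 0.
  by rewrite mxE; apply: eq_bigr => i _; rewrite mxE.
by rewrite !dotE trmx_mul trmxK mulmxA.
Qed.

Lemma l2norm_ge0 k (u : 'cV[R]_k) : 0 <= l2norm u.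
Proof. exact: sqrtr_ge0. Qed.

Lemma sqr_l2norm k (u : 'cV[R]_k) : l2norm u ^+ 2 = dotv u u.
Proof.
rewrite sqr_sqrtr; first by apply: eq_bigr => i _; rewrite expr2.
by apply: sumr_ge0 => i _; exact: sqr_ge0.
Qed.

Lemma sqr_l2normD k (u v : 'cV[R]_k) :
  l2norm (u + v) ^+ 2 = dotv u u + 2 * dotv u v + dotv v v.
Proof. by rewrite sqr_l2norm dotvDl !dotvDr (dotvC v u); ring. Qed.

Lemma dotvv_ge0 k (u : 'cV[R]_k) : 0 <= dotv u u.
Proof. by rewrite -sqr_l2norm sqr_ge0. Qed.

Lemma l2norm_eq0 k (u : 'cV[R]_k) : l2norm u = 0 -> u = 0.
Proof.
move=> u0; have := sqr_l2norm u; rewrite u0 expr0n /= => /esym/eqP.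
rewrite psumr_eq0 => [/allP u00|i _]; last by rewrite -expr2 sqr_ge0.
apply/colP => i; rewrite mxE; apply/eqP.
by have := u00 i (mem_index_enum i); rewrite /= mulf_eq0 orbb.
Qed.

Lemma l2norm0 k : l2norm (0 : 'cV[R]_k) = 0.
Proof.
by rewrite /l2norm big1 ?sqrtr0// => i _; rewrite mxE expr0n.
Qed.

Lemma cauchy_schwarz_sqr k (u v : 'cV[R]_k) :
  dotv u v ^+ 2 <= dotv u u * dotv v v.
Proof.
have [v0|v_neq0] := eqVneq (l2norm v) 0.
  by rewrite (l2norm_eq0 v0) -(scale0r v) !dotvZr !mul0r expr0n mulr0.
have v_gt0 : 0 < dotv v v.
  by rewrite -sqr_l2norm exprn_gt0// lt_neqAle eq_sym v_neq0 l2norm_ge0.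
rewrite -(ler_pM2l v_gt0) -subr_ge0.
(* With [c], [p], [q] as named below, the square of [q u - c v] equals [q (p q - c^2)]: the goal
   after its multiplication by [q]. *)
have := dotvv_ge0 (dotv v v *: u + (- dotv u v) *: v).
rewrite !(dotvDl, dotvDr, dotvZl, dotvZr) (dotvC v u).
by set c := dotv u v; set p := dotv u u; set q := dotv v v; nra.
Qed.

Lemma cauchy_schwarz k (u v : 'cV[R]_k) : `|dotv u v| <= l2norm u * l2norm v.
Proof.
rewrite -ler_sqr ?nnegrE ?mulr_ge0 ?l2norm_ge0//.
by rewrite real_normK ?num_real// exprMn !sqr_l2norm cauchy_schwarz_sqr.
Qed.

Lemma l2normD k (u v : 'cV[R]_k) : l2norm (u + v) <= l2norm u + l2norm v.
Proof.
rewrite -ler_sqr ?nnegrE ?addr_ge0 ?l2norm_ge0//.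
rewrite sqrrD sqr_l2normD !sqr_l2norm.
have := le_trans (ler_norm _) (cauchy_schwarz u v); lra.
Qed.

Lemma l2normZ k a (u : 'cV[R]_k) : l2norm (a *: u) = `|a| * l2norm u.
Proof.
apply/eqP; rewrite -(@eqrXn2 _ 2) ?mulr_ge0 ?l2norm_ge0//.
by rewrite exprMn !sqr_l2norm dotvZl dotvZr mulrA real_normK ?num_real.
Qed.

Lemma l2normN k (u : 'cV[R]_k) : l2norm (- u) = l2norm u.
Proof. by rewrite -scaleN1r l2normZ normrN1 mul1r. Qed.

(** Each coordinate of [M^T *m v] pairs a column of [M] with [v]; the squared Cauchy-Schwarz bounds
    add up over the columns. *)
Lemma l2norm_mulmx_tr p q (M : 'M[R]_(p, q)) (v : 'cV[R]_p) :
  l2norm (M^T *m v) <= l2norm v * frobenius_norm M.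
Proof.
have S_ge0 : 0 <= \sum_i \sum_j M i j ^+ 2.
  by apply: sumr_ge0 => i _; apply: sumr_ge0 => j _; exact: sqr_ge0.
rewrite -ler_sqr ?nnegrE ?mulr_ge0 ?l2norm_ge0 ?sqrtr_ge0//.
rewrite exprMn !sqr_l2norm sqr_sqrtr// exchange_big mulr_sumr.
apply: ler_sum => j _; rewrite -expr2 mulrC.
have -> : (M^T *m v) j 0 = dotv (col j M) v.
  by rewrite mxE; apply: eq_bigr => i _; rewrite !mxE.
apply: le_trans (cauchy_schwarz_sqr _ _) _; rewrite ler_wpM2r ?dotvv_ge0//.
by apply: ler_sum => i _; rewrite !mxE expr2.
Qed.

End EuclideanSpace.

(** * Weak duality, first-order optimality and quadratic growth *)

Lemma weak_duality (R : realType) d n (f : 'cV[R]_d -> R) (h : 'cV[R]_n -> R)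
    (A : 'M[R]_(d, n)) x y :
  (duality_gap f (EFin \o h) A x < +oo)%E ->
  f (A *m x) + h x - (f (A *m y) + h y)
    <= fine (duality_gap f (EFin \o h) A x).
Proof.
rewrite /duality_gap; set w := gradient f _.
have conj_ge k (phi : 'cV[R]_k -> R) v u :
    ((dotv v u - phi u)%:E <= convex_conjugate (EFin \o phi) v)%E.
  by apply: ereal_sup_ubound; exists u.
(* Both suprema are bounded below at [A *m y] and [y]; the two pairings with [w] are opposite and
   cancel in the sum. *)
have := conj_ge _ f w (A *m y); have := conj_ge _ h (- (A^T *m w)) y.
rewrite dotvNl dotv_trmx.
(* These bounds exclude [-oo] for both conjugates, so a value [+oo] of either would make the gap
   infinite. *)
case: (convex_conjugate _ _) => [p| |] //; rewrite ?leeNy_eq//; last first.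
  by case: (convex_conjugate _ _).
case: (convex_conjugate _ _) => [q| |] //; rewrite ?leeNy_eq//.
by rewrite -!EFinD !lee_fin /= => ? ? _; lra.
Qed.

(* Compare xstar with xstar + t (y - xstar): the gain c t of first order in t
   would beat the quadratic cost t^2 |D|^2 / 2 at t = -c / (|D|^2 - c). *)
Lemma optimality_variational (R : realType) d n (h : 'cV[R]_n -> R)
    (A : 'M[R]_(d, n)) b xstar :
  (forall t x y, 0 < t <= 1 ->
     h (x + t *: (y - x)) <= (1 - t) * h x + t * h y) ->
  (forall y, least_squares b (A *m xstar) + h xstar
     <= least_squares b (A *m y) + h y) ->
  forall y, 0 <= dotv (A *m xstar - b) (A *m (y - xstar)) + h y - h xstar.
Proof.
move=> h_convex opt y; set r := A *m xstar - b; set D := A *m (y - xstar).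
have step t : 0 < t <= 1 ->
    0 <= dotv r D + h y - h xstar + t * (2^-1 * dotv D D).
  move=> t01; have := opt (xstar + t *: (y - xstar)).
  have /andP[t_gt0 _] := t01.
  have := h_convex _ xstar y t01.
  rewrite /least_squares mulmxDr -scalemxAr -/D addrAC -/r.
  rewrite (sqr_l2normD r) sqr_l2norm dotvZl !dotvZr => hle ole.
  rewrite -(pmulr_rge0 _ t_gt0).
  set hz := h (_ + _) in hle ole; nra.
rewrite leNgt; apply/negP; set c := _ - h xstar => c_lt0.
have D_ge0 := dotvv_ge0 D.
have q_gt0 : 0 < dotv D D - c by lra.
have t_gt0 : 0 < - c / (dotv D D - c) by rewrite divr_gt0// oppr_gt0.
have t_le1 : - c / (dotv D D - c) <= 1 by rewrite ler_pdivrMr//; lra.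
(* For this [t], [c + t |D|^2 / 2 = t c - t |D|^2 / 2], which is negative. *)
have := step (- c / (dotv D D - c)); rewrite t_gt0 t_le1 -/c => /(_ isT).
have : - c / (dotv D D - c) * (dotv D D - c) = - c by rewrite divfK// gt_eqF.
by set t := _ / _ in t_gt0 t_le1 *; nra.
Qed.

Lemma least_squares_growth (R : realType) d n (h : 'cV[R]_n -> R)
    (A : 'M[R]_(d, n)) b xstar y :
  0 <= dotv (A *m xstar - b) (A *m (y - xstar)) + h y - h xstar ->
  2^-1 * l2norm (A *m (y - xstar)) ^+ 2 <=
    least_squares b (A *m y) + h y - (least_squares b (A *m xstar) + h xstar).
Proof.
(* Centred at the residual of [xstar], the square has as cross term the pairing in the
   hypothesis. *)
have -> : least_squares b (A *m y) =
    2^-1 * l2norm ((A *m xstar - b) + A *m (y - xstar)) ^+ 2.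
  by rewrite mulmxBr [_ - b + _]addrC addrA subrK.
by rewrite /least_squares (sqr_l2normD (_ - b)) !sqr_l2norm; lra.
Qed.

(** * Blocks of coordinates and the group penalty *)

Section Groups.
Variables (R : realType) (n m : nat) (grp : 'I_m -> {set 'I_n}).
Variables (lambda : R) (rho : 'I_m -> R).

Lemma subvectorD (S : {set 'I_n}) (x y : 'cV[R]_n) :
  subvector S (x + y) = subvector S x + subvector S y.
Proof. by apply/colP => k; rewrite !mxE. Qed.

Lemma subvectorZ (S : {set 'I_n}) a (x : 'cV[R]_n) :
  subvector S (a *: x) = a *: subvector S x.
Proof. by apply/colP => k; rewrite !mxE. Qed.

Lemma dotv_subvector (S : {set 'I_n}) (x y : 'cV[R]_n) :
  dotv (subvector S x) (subvector S y) = \sum_(i in S) x i 0 * y i 0.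
Proof.
by rewrite [RHS]big_enum_val; apply: eq_bigr => k _; rewrite !mxE.
Qed.

Lemma subvector_mulmx_tr d (S : {set 'I_n}) (A : 'M[R]_(d, n)) v :
  subvector S (A^T *m v) = (subcolumns S A)^T *m v.
Proof.
by apply/colP => k; rewrite !mxE; apply: eq_bigr => i _; rewrite !mxE.
Qed.

Lemma group_penalty_convex t x y : 0 <= lambda -> 0 < t <= 1 ->
  group_penalty grp lambda rho (x + t *: (y - x))
    <= (1 - t) * group_penalty grp lambda rho x
       + t * group_penalty grp lambda rho y.
Proof.
move=> lambda_ge0 /andP[t_gt0 t_le1].
rewrite /group_penalty !(mulrCA _ lambda) -mulrDr ler_wpM2l//.
rewrite !mulr_sumr -big_split ler_sum// => g _ /=.
rewrite !(mulrCA _ (Num.sqrt _)) -mulrDr ler_wpM2l ?sqrtr_ge0//.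
have -> : x + t *: (y - x) = (1 - t) *: x + t *: y.
  by rewrite scalerBr scalerBl scale1r addrA addrAC.
rewrite subvectorD !subvectorZ; apply: le_trans (l2normD _ _) _.
by rewrite !l2normZ (ger0_norm (ltW t_gt0)) ger0_norm ?subr_ge0.
Qed.

(** The competitor against which the optimality of [xstar] is tested. *)
Definition zero_on (S : {set 'I_n}) (x : 'cV[R]_n) : 'cV[R]_n :=
  \col_i (if i \in S then 0 else x i 0).

(** Disjointness leaves every other block untouched, so only the summand of [g] is lost. *)
Lemma group_penalty_zero_on g x :
  (forall g', g != g' -> [disjoint grp g & grp g']) ->
  group_penalty grp lambda rho (zero_on (grp g) x) =
  group_penalty grp lambda rho x
    - lambda * Num.sqrt (rho g) * l2norm (subvector (grp g) x).
Proof.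
move=> g_disj; rewrite /group_penalty (bigD1 g)//= [in RHS](bigD1 g)//=.
have -> : subvector (grp g) (zero_on (grp g) x) = 0.
  by apply/colP => k; rewrite !mxE enum_valP.
rewrite l2norm0 mulr0 add0r mulrDr mulrA addrAC subrr add0r.
congr (_ * _); apply: eq_bigr => g' gg'; congr (_ * l2norm _).
apply/colP => k; rewrite !mxE.
by rewrite (disjointFl (g_disj g' _) (enum_valP k)) 1?eq_sym.
Qed.

(** The difference is supported on [S], where it equals [- x]. *)
Lemma dotv_zero_on (S : {set 'I_n}) u x :
  dotv u (zero_on S x - x) = - dotv (subvector S u) (subvector S x).
Proof.
rewrite dotv_subvector -sumrN [RHS]big_mkcond; apply: eq_bigr => i _.
by rewrite !mxE; case: ifP => _; rewrite ?sub0r ?mulrN ?subrr ?mulr0.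
Qed.

End Groups.

(** * The gap-based screening rule *)

Theorem corollary19 (R : realType) (d n m : nat)
  (grp : 'I_m -> {set 'I_n})
  (grp_disj : forall g g' : 'I_m, g != g' -> [disjoint grp g & grp g'])
  (grp_cover : forall i : 'I_n, exists g : 'I_m, i \in grp g)
  (A : 'M[R]_(d, n)) (b : 'cV[R]_d)
  (lambda : R) (lambda_gt0 : 0 < lambda)
  (rho : 'I_m -> R) (rho_gt0 : forall g : 'I_m, 0 < rho g)
  (xstar : 'cV[R]_n)
  (xstar_opt : forall y : 'cV[R]_n,
     least_squares b (A *m xstar) + group_penalty grp lambda rho xstar
     <= least_squares b (A *m y) + group_penalty grp lambda rho y)
  (x : 'cV[R]_n) (g : 'I_m) :
  (group_lasso_gap grp A b lambda rho x < +oo)%E ->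
  l2norm ((subcolumns (grp g) A)^T *m (A *m x - b))
    + Num.sqrt (2 * fine (group_lasso_gap grp A b lambda rho x))
      * frobenius_norm (subcolumns (grp g) A)
  < lambda * Num.sqrt (rho g) ->
  subvector (grp g) xstar = 0.
Proof.
move=> gap_fin screen.
have var := optimality_variational
  (fun t x y => group_penalty_convex grp rho x y (ltW lambda_gt0)) xstar_opt.
have growth := least_squares_growth (var x).
have := le_trans growth (weak_duality xstar gap_fin).
rewrite -/(group_lasso_gap grp A b lambda rho x).
set G := fine _ in screen * => half_le.
have dist_le : l2norm (A *m (x - xstar)) <= Num.sqrt (2 * G).
  rewrite -(ger0_norm (l2norm_ge0 _)) -sqrtr_sqr ler_wsqrtr//; lra.
set Ag := subcolumns (grp g) A in screen.
have res_lt : l2norm (Ag^T *m (A *m xstar - b)) < lambda * Num.sqrt (rho g).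
  (* Moving from [x] to [xstar] costs at most the distance [dist_le] times the Frobenius norm of
     [Ag], the second term of [screen]. *)
  have -> : Ag^T *m (A *m xstar - b) =
      Ag^T *m (A *m x - b) + Ag^T *m (A *m (xstar - x)).
    rewrite -mulmxDr; congr (_ *m _).
    by rewrite mulmxBr [_ - b + _]addrC addrA subrK.
  apply: le_lt_trans (l2normD _ _) (le_lt_trans _ screen).
  rewrite lerD2l; apply: le_trans (l2norm_mulmx_tr _ _) _.
  rewrite ler_wpM2r ?sqrtr_ge0//; apply: le_trans _ dist_le.
  by rewrite -opprB mulmxN l2normN.
have := var (zero_on (grp g) xstar).
rewrite -dotv_trmx dotv_zero_on subvector_mulmx_tr -/Ag.
rewrite group_penalty_zero_on => [opt_g|g' gg']; last exact: grp_disj.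
apply: l2norm_eq0; apply/eqP; rewrite eq_le l2norm_ge0 andbT leNgt.
apply/negP => xg_gt0.
(* By [opt_g], [lambda * Num.sqrt (rho g)] times the norm of the block is at most minus the pairing;
   Cauchy-Schwarz, with the sign put on the block, and [res_lt] make it strictly smaller than
   itself. *)
have := le_trans (ler_norm _)
  (cauchy_schwarz (Ag^T *m (A *m xstar - b)) (- subvector (grp g) xstar)).
have := res_lt; rewrite -(ltr_pM2r xg_gt0).
by rewrite l2normN dotvNr; lra.
Qed.
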